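(* For every prime $p$ there is a finite solvable algebra $\mathbf A$ with a Malcev term such that $\mathrm{nuP}_{\mathbf A}=\mathsf{nuDet}_p$.
   Context: A finite algebra has finite universe and finitely many basic operations. An $n$-ary circuit over $\mathbf A$ is a DAG with one output node, sources labelled by variables or constants from $A$, gates labelled by basic operations; size is nodes plus edges. A NuDFA over $\mathbf A$ is $(\{t_n\}_{n\ge1},\iota,S)$ with $t_n$ an $n$-ary circuit, $\iota:\{0,1\}\to A$, $S\subseteq A$, accepting $b\in\{0,1\}^n$ iff $t_n(\iota(b_1),\dots,\iota(b_n))\in S$; polynomial size means size of $t_n$ polynomial in $n$; $\mathrm{nuP}_{\mathbf A}$ is the class of languages over $\{0,1\}$ accepted by polynomial-size NuDFAs over $\mathbf A$. A Malcev term is a ternary term $d$ with $d(x,y,y)=d(y,y,x)=x$; solvability is in the sense of commutator theory. An algebraic branching program (ABP) over $\mathrm{GF}(p)$ is a directed acyclic multigraph with one source and one sink whose edges are labelled by variables or constants of $\mathrm{GF}(p)$; it computes the polynomial equal to the sum over all source–sink paths of the product of the edge labels; its size is the number of vertices plus edges. A $\mathrm{BABP}_p$ gate is labelled by an $n$-variate ABP over $\mathrm{GF}(p)$ and an accepting set $T\subseteq\mathrm{GF}(p)$; on Boolean inputs $b\in\{0,1\}^n$ it outputs 1 iff the ABP's polynomial evaluated at $b$ lies in $T$; its size is that of the ABP. $\mathsf{nuDet}_p$ is the class of languages $L\subseteq\{0,1\}^*$ such that for each $n$, $L\cap\{0,1\}^n$ is recognized by a single $\mathrm{BABP}_p$ gate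 of size polynomial in $n$. *)

(* Defs.v *)
From HB Require Import structures.
From mathcomp Require Import all_boot all_order all_algebra.
From mathcomp Require Import mpoly.
Set Implicit Arguments. Unset Strict Implicit. Unset Printing Implicit Defensive.
Import GRing.Theory.

Record finAlg := FinAlg {
  carrier :> finType;
  nops : nat;
  arity : 'I_nops -> nat;
  op : forall i : 'I_nops, (arity i).-tuple carrier -> carrier }.

Arguments op {f} i _.

(* apply a basic operation to a list of arguments (padded with x0 /
   truncated; only used with lists of the right length) *)
Definition op_seq (A : finAlg) (x0 : A) (f : 'I_(nops A)) (vs : seq A) : A :=
  op f (mktuple (fun j : 'I_(arity f) => nth x0 vs j)).

Inductive term (k : nat) : Type :=
| TVar of nat
| TOp of 'I_k & seq (term k).

Fixpoint twf (A : finAlg) (m : nat) (t : term (nops A)) : bool :=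
  match t with
  | TVar i => i < m
  | TOp f ts => (size ts == arity f) && all (twf m) ts
  end.

Fixpoint teval (A : finAlg) (e : nat -> A) (t : term (nops A)) : A :=
  match t with
  | TVar i => e i
  | TOp f ts => op_seq (e 0) f (map (teval e) ts)
  end.

Definition has_malcev (A : finAlg) : Prop :=
  exists d : term (nops A), twf 3 d /\
    forall x y : A, teval (nth x [:: x; y; y]) d = x /\
                    teval (nth x [:: y; y; x]) d = x.

Definition is_congruence (A : finAlg) (th : A -> A -> Prop) : Prop :=
  [/\ (forall x, th x x), (forall x y, th x y -> th y x),
      (forall x y z, th x y -> th y z -> th x z) &
      (forall (f : 'I_(nops A)) (u v : (arity f).-tuple A),
          (forall j, th (tnth u j) (tnth v j)) -> th (op f u) (op f v))].

(* term condition: C(alpha, beta; delta).  The variables in [X] are the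
   "x-variables" (receiving alpha-related values a, b), the others are
   the "y-variables" (receiving beta-related values c, d). *)
Definition centralizes (A : finAlg) (alpha beta delta : A -> A -> Prop) : Prop :=
  forall (m : nat) (t : term (nops A)) (X : pred nat) (a b c d : nat -> A),
    twf m t ->
    (forall i, alpha (a i) (b i)) -> (forall i, beta (c i) (d i)) ->
    let val u w := fun i => if X i then u i else w i in
    delta (teval (val a c) t) (teval (val a d) t) ->
    delta (teval (val b c) t) (teval (val b d) t).

Definition commutator (A : finAlg) (alpha beta : A -> A -> Prop) : A -> A -> Prop :=
  fun x y => forall delta : A -> A -> Prop,
    is_congruence delta -> centralizes alpha beta delta -> delta x y.

Fixpoint derived (A : finAlg) (k : nat) : A -> A -> Prop :=
  match k with
  | 0 => fun _ _ => True
  | k'.+1 => commutator (@derived A k') (@derived A k')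
  end.

Definition solvable_alg (A : finAlg) : Prop :=
  exists k, forall x y : A, @derived A k x y <-> x = y.

(* A circuit is a list of nodes in topological order; the last node is
   the output.  A gate lists the (earlier) nodes feeding its argument
   positions. *)
Inductive cnode (A : finAlg) : Type :=
| CVar of nat
| CConst of A
| CGate of 'I_(nops A) & seq nat.

Definition circuit (A : finAlg) := seq (cnode A).

Fixpoint cwf_from (A : finAlg) (n j : nat) (c : circuit A) : bool :=
  match c with
  | [::] => true
  | nd :: c' =>
    match nd with
    | CVar i => i < n
    | CConst _ => true
    | CGate f args => (size args == arity f) && all (fun u => u < j) args
    end && cwf_from n j.+1 c'
  end.

Definition cwf (A : finAlg) (n : nat) (c : circuit A) : bool :=
  (0 < size c) && cwf_from n 0 c.

Definition node_size (A : finAlg) (nd : cnode A) : nat :=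
  match nd with CGate _ args => size args | _ => 0 end.

Definition csize (A : finAlg) (c : circuit A) : nat :=
  size c + \sum_(nd <- c) node_size nd.

Fixpoint cvals (A : finAlg) (x0 : A) (inp : seq A) (vals : seq A)
    (c : circuit A) : seq A :=
  match c with
  | [::] => vals
  | nd :: c' =>
    let v := match nd with
             | CVar i => nth x0 inp i
             | CConst a => a
             | CGate f args => op_seq x0 f (map (nth x0 vals) args)
             end in
    cvals x0 inp (rcons vals v) c'
  end.

Definition ceval (A : finAlg) (x0 : A) (inp : seq A) (c : circuit A) : A :=
  last x0 (cvals x0 inp [::] c).

(* nuP_A: languages accepted by polynomial-size NuDFAs over A.  The
   NuDFA only speaks about words of length n >= 1. *)
Definition nuP (A : finAlg) (L : seq bool -> Prop) : Prop :=
  exists (t : nat -> circuit A) (iota : bool -> A) (S : {set A}) (k : nat),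
    (forall n, 0 < n -> cwf n (t n) /\ csize (t n) <= n ^ k + k) /\
    (forall b : seq bool, 0 < size b ->
       (L b <-> ceval (iota false) (map iota b) (t (size b)) \in S)).

(* vertices 0 .. abp_nv - 1 (numbered in a topological order), source 0,
   sink abp_nv - 1; edges (u, v, label), label inl i = variable x_i,
   inr c = constant c. *)
Record abp (F : fieldType) := ABP {
  abp_nv : nat;
  abp_edges : seq (nat * nat * (nat + F)) }.

Definition abp_wf (F : fieldType) (n : nat) (G : abp F) : bool :=
  (0 < abp_nv G) &&
  all (fun e : nat * nat * (nat + F) =>
         [&& e.1.1 < e.1.2, e.1.2 < abp_nv G &
             match e.2 with inl i => i < n | inr _ => true end])
      (abp_edges G).

Definition abp_size (F : fieldType) (G : abp F) : nat :=
  abp_nv G + size (abp_edges G).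

Fixpoint is_path (F : fieldType) (es : seq (nat * nat * (nat + F)))
    (u : nat) (s : seq nat) (w : nat) : bool :=
  match s with
  | [::] => u == w
  | i :: s' =>
    [&& i < size es, (nth (0, 0, inr 0%R) es i).1.1 == u &
        is_path es (nth (0, 0, inr 0%R) es i).1.2 s' w]
  end.

Definition label_poly (F : fieldType) (n : nat) (l : nat + F) : {mpoly F[n]} :=
  match l with
  | inl i => match insub i with Some j => 'X_j | None => 0%R end
  | inr c => c%:MP
  end.

(* the polynomial computed by the ABP: sum over all source-sink paths of
   the product of the edge labels (paths in the DAG have < abp_nv edges) *)
Definition abp_poly (F : fieldType) (n : nat) (G : abp F) : {mpoly F[n]} :=
  let es := abp_edges G in
  (\sum_(k < abp_nv G)
    \sum_(s : k.-tuple 'I_(size es) | is_path es 0 (map val s) (abp_nv G).-1)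
      \prod_(i <- s) label_poly n (nth (0, 0, inr 0%R) es i).2)%R.

Definition babp_accepts (F : fieldType) (n : nat) (G : abp F) (T : pred F)
    (b : seq bool) : bool :=
  (abp_poly n G).@[fun i : 'I_n => ((nth false b i : nat)%:R)%R] \in T.

Definition nuDet (p : nat) (L : seq bool -> Prop) : Prop :=
  exists k : nat, forall n : nat,
    exists (G : abp 'F_p) (T : pred 'F_p),
      [/\ abp_wf n G, abp_size G <= n ^ k + k &
          forall b : seq bool, size b = n -> (L b <-> babp_accepts n G T b)].

(* Main.v *)
(* The algebra is F x F, F = GF(p), with the single operation
     (u1 - v1 + w1, u2 - v2 + w2 + (s1 - v1) t2).
   First coordinates of gates are affine in the Boolean inputs, and second
   coordinates are updated linearly with first coordinates as multipliers, so
   second coordinates of polynomial-size circuits are exactly the functions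
   computed by polynomial-size branching programs.  Both models are compared with
   straight-line programs whose instructions add [label * value] to a value; the
   functions these compute are closed under sums and products, hence under any
   fixed map F x F -> F, which turns arbitrary accepting sets into the test
   [value = 1].  The kernel of the first projection contains [1,1] and is abelian. *)
Require Import Defs.
From HB Require Import structures.
From mathcomp Require Import all_boot all_order all_algebra all_field.
From mathcomp Require Import mpoly.
From mathcomp Require Import ring zify.
From Stdlib Require Import ClassicalEpsilon.
Set Implicit Arguments. Unset Strict Implicit. Unset Printing Implicit Defensive.
Import GRing.Theory.

Local Open Scope ring_scope.

(** * Straight-line programs *)

Section Programs.
Variable F : finFieldType.
Implicit Types (f g h : seq bool -> F) (n : nat).

Definition lab (b : seq bool) (l : nat + F) : F :=
  match l with inl i => (nth false b i : nat)%:R | inr c => c end.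

Definition lab_ok n (l : nat + F) : bool :=
  match l with inl i => (i < n)%N | inr _ => true end.

(* The instruction [(a, l, y)] pushes [env_a + l * env_y], where operands are
   de Bruijn positions in the environment (newest value first). *)
Definition prog := seq (nat * (nat + F) * nat).

Fixpoint run (b : seq bool) (P : prog) : seq F :=
  match P with
  | [::] => [:: 0; 1]
  | (a, l, y) :: P' =>
      let env := run b P' in env`_a + lab b l * env`_y :: env
  end.

Fixpoint pwf n (P : prog) : bool :=
  if P is (a, l, y) :: P' then
    [&& lab_ok n l, (a < (size P').+2)%N, (y < (size P').+2)%N & pwf n P']
  else true.

Definition computes n (P : prog) f : Prop :=
  exists2 i, (i < (size P).+2)%N & forall b, size b = n -> (run b P)`_i = f b.

Definition grows n k (P Q : prog) : Prop :=
  [/\ pwf n Q, (size Q <= size P + k)%N &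
      forall f, computes n P f -> computes n Q f].

Definition comp n s f : Prop :=
  exists P, [/\ pwf n P, (size P <= s)%N & computes n P f].

Lemma size_run b P : size (run b P) = (size P).+2.
Proof. by elim: P => [|[[a l] y] P IH] //=; rewrite IH. Qed.

Lemma eq_computes n P f g :
  (forall b, size b = n -> f b = g b) -> computes n P f -> computes n P g.
Proof. by move=> fg [i iP Hi]; exists i => // b bn; rewrite Hi ?fg. Qed.

Lemma eq_comp n s f g :
  (forall b, size b = n -> f b = g b) -> comp n s f -> comp n s g.
Proof. by move=> fg [P [wP sP /(eq_computes fg)]]; exists P. Qed.

Lemma comp_le n s t f : (s <= t)%N -> comp n s f -> comp n t f.
Proof. by move=> st [P [wP sP Pf]]; exists P; split=> //; apply: leq_trans st. Qed.

Lemma growsxx n P : pwf n P -> grows n 0 P P.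
Proof. by move=> wP; split; rewrite ?addn0. Qed.

Lemma grows_trans n k l P Q R :
  grows n k P Q -> grows n l Q R -> grows n (k + l) P R.
Proof. by move=> [_ s1 h1] [w2 s2 h2]; split=> // [|f /h1/h2 //]; lia. Qed.

Lemma grows_le n k l P Q : (k <= l)%N -> grows n k P Q -> grows n l P Q.
Proof. by move=> kl [w s h]; split=> //; lia. Qed.

Lemma grows_step n P f g l :
    pwf n P -> lab_ok n l -> computes n P f -> computes n P g ->
  exists2 Q, grows n 1 P Q & computes n Q (fun b => f b + lab b l * g b).
Proof.
move=> wP wl [a aP Ha] [y yP Hy]; exists ((a, l, y) :: P); last first.
  by exists 0%N => // b bn /=; rewrite Ha ?Hy.
split=> /= [||h [i iP Hi]]; [by rewrite wl aP yP|by rewrite addn1|].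
by exists i.+1.
Qed.

Lemma computes0 n P : computes n P (fun=> 0).
Proof.
elim: P => [|[[a l] y] P [i iP Hi]]; first by exists 0%N.
by exists i.+1.
Qed.

Lemma computes1 n P : computes n P (fun=> 1).
Proof.
elim: P => [|[[a l] y] P [i iP Hi]]; first by exists 1%N.
by exists i.+1.
Qed.

(* Every value of a program is linear in the base value 1, so running [Q] with
   [f] in place of 1 multiplies all its values by [f]. *)
Lemma grows_mul n P f Q : pwf n P -> computes n P f -> pwf n Q ->
  exists2 R, grows n (size Q) P R &
    forall g, computes n Q g -> computes n R (fun b => f b * g b).
Proof.
move=> wP Pf; elim: Q => [_|[[a l] y] Q IH /= /and4P[wl _ _ /IH[R gR HR]]].
  exists P; first exact: growsxx.
  move=> g [[|[|//]] _ Hi].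
    by apply: eq_computes (computes0 n P) => b bn; rewrite -Hi //= mulr0.
  by apply: eq_computes Pf => b bn; rewrite -Hi //= mulr1.
(* Positions outside the environment read as the default 0, so no bound on [i] is needed here. *)
have val_R i : computes n R (fun b => f b * (run b Q)`_i).
  case: (ltnP i (size Q).+2) => iQ; first by apply: HR; exists i.
  apply: eq_computes (computes0 n R) => b bn.
  by rewrite nth_default ?mulr0 // size_run.
have wR : pwf n R by case: gR.
have [S gS HS] := grows_step wR wl (val_R a) (val_R y).
exists S; first by rewrite -addn1; apply: grows_trans gR gS.
move=> g [[|i] /= iQ Hi].
  by apply: eq_computes HS => b bn; rewrite -Hi //=; ring.
case: gS => _ _; apply; apply: HR; exists i => // b bn; exact: Hi.
Qed.

(** * Closure of programs under arithmetic and finite functions *)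

Lemma comp_mul n s t f g :
  comp n s f -> comp n t g -> comp n (s + t) (fun b => f b * g b).
Proof.
move=> [P [wP sP Pf]] [Q [wQ sQ Qg]].
have [R [wR sR _] HR] := grows_mul wP Pf wQ.
by exists R; split=> //; [lia|apply: HR].
Qed.

Lemma comp_add n s t f g :
  comp n s f -> comp n t g -> comp n (s + t).+1 (fun b => f b + g b).
Proof.
move=> [P [wP sP Pf]] [Q [wQ sQ Qg]].
(* Multiplying [Q] by the constant function 1 amounts to appending [Q] to [P]. *)
have [R [wR sR HR1] HR] := grows_mul wP (computes1 n P) wQ.
have Rg : computes n R g.
  by apply: eq_computes (HR _ Qg) => b _; rewrite mul1r.
have [S [wS sS _] HS] := grows_step wR (isT : lab_ok n (inr 1)) (HR1 _ Pf) Rg.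
exists S; split=> //; first by lia.
by apply: eq_computes HS => b _ /=; rewrite mul1r.
Qed.

Lemma comp_const n (c : F) : comp n 1 (fun=> c).
Proof.
have [Q [wQ sQ _] HQ] :=
  grows_step (isT : pwf n [::]) (isT : lab_ok n (inr c))
             (computes0 n [::]) (computes1 n [::]).
by exists Q; split=> //; apply: eq_computes HQ => b _ /=; rewrite add0r mulr1.
Qed.

Lemma comp_exp n s f k : comp n s f -> comp n (k * s).+1 (fun b => f b ^+ k).
Proof.
move=> cf; elim: k => [|k IH].
  by apply: eq_comp (comp_const n 1) => b _; rewrite expr0.
apply: (@comp_le n (s + (k * s).+1)); first by lia.
by apply: eq_comp (comp_mul cf IH) => b _; rewrite exprS.
Qed.

Lemma comp_sum n s (I : Type) (r : seq I) (f : I -> seq bool -> F) :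
    (forall i, comp n s (f i)) ->
  comp n (size r * s.+1).+1 (fun b => \sum_(i <- r) f i b).
Proof.
move=> cf; elim: r => [|i r IH].
  by apply: eq_comp (comp_const n 0) => b _; rewrite big_nil.
apply: (@comp_le n (s + (size r * s.+1).+1).+1); first by rewrite /=; lia.
by apply: eq_comp (comp_add (cf i) IH) => b _; rewrite big_cons.
Qed.

(** Nonzero elements satisfy [x ^+ (#|F| - 1) = 1], so equality tests are polynomials of fixed
    degree. *)
Lemma indicator_pow (x : F) : 1 - x ^+ #|F|.-1 = (x == 0)%:R.
Proof.
have F1 : (1 < #|F|)%N by exact: finRing_gt1.
case: eqP => [->|/eqP x0]; first
  by rewrite expr0n; case: #|F| F1 => [|[|]] //= k _; rewrite subr0.
have := expf_card x; rewrite -[in LHS](prednK (ltnW F1)) exprS.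
by move=> /(canRL (mulKf x0)) ->; rewrite mulVf // subrr.
Qed.

Lemma comp_eq n s f (c : F) :
  comp n s f -> comp n (#|F| * (s + 9)) (fun b => (f b == c)%:R).
Proof.
move=> cf; have F1 : (1 < #|F|)%N by exact: finRing_gt1.
have c1 := comp_add cf (comp_const n (- c)).
have c2 := comp_mul (comp_const n (-1)) (comp_exp #|F|.-1 c1).
have c3 := comp_add (comp_const n 1) c2.
apply: eq_comp (comp_le _ c3) => [b _|]; last by nia.
by rewrite mulN1r indicator_pow subr_eq0.
Qed.

(** Interpolation: [phi (f b) (g b)] is the sum over all pairs [x] of [phi x.1 x.2] times the
    indicators of [f b = x.1] and [g b = x.2]. The number of terms depends on [F] only, so the size
    grows by a constant factor. *)
Lemma comp_fun2 (phi : F -> F -> F) n s t f g : comp n s f -> comp n t g ->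
  comp n (#|{: F * F}| * (#|F| * (s + t + 20))).+1 (fun b => phi (f b) (g b)).
Proof.
move=> cf cg; have F1 : (1 < #|F|)%N by exact: finRing_gt1.
have cx (x : F * F) : comp n (#|F| * (s + t + 19))
    (fun b => phi x.1 x.2 * ((f b == x.1)%:R * (g b == x.2)%:R)).
  apply: comp_le (comp_mul (comp_const n _)
    (comp_mul (comp_eq x.1 cf) (comp_eq x.2 cg))).
  by nia.
have := comp_sum (index_enum _) cx.
rewrite -[X in size X]filter_predT -cardE.
move=> h; apply: eq_comp (comp_le _ h); last first.
  rewrite ltnS; apply: leq_mul; last by nia.
  by rewrite cardT.
move=> b _ /=; rewrite (bigD1 (f b, g b)) //= !eqxx !mulr1 big1 ?addr0 //.
move=> [x y] /=; rewrite xpair_eqE negb_and ![_ == f b]eq_sym ![_ == g b]eq_sym.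
by case/orP=> /negPf ->; rewrite ?mul0r !mulr0.
Qed.

End Programs.
(** * Algebraic branching programs *)

Section BranchingPrograms.
Variable F : finFieldType.
Implicit Types (f : seq bool -> F) (n : nat) (es : seq (nat * nat * (nat + F))).

(* [walk_sum es w b K u] is the sum of the weights of the walks from [u] to [w]
   with fewer than [K] edges. *)
Fixpoint walk_sum es (w : nat) (b : seq bool) (K u : nat) : F :=
  if K is K'.+1 then
    (u == w)%:R +
    \sum_(e <- es | e.1.1 == u) lab b e.2 * walk_sum es w b K' e.1.2
  else 0.

Lemma big_tupleS (R : nmodType) (I : finType) k (f : seq I -> R) :
  \sum_(s : k.+1.-tuple I) f s = \sum_i \sum_(s : k.-tuple I) f (i :: s).
Proof.
rewrite pair_big /= (reindex (fun x : I * k.-tuple I => [tuple of x.1 :: x.2])) //=.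
exists (fun s => (thead s, [tuple of behead s])) => [[i s] _|s _] /=.
  by congr pair; apply: val_inj.
by rewrite -tuple_eta.
Qed.

(** Splitting off the first edge of a path turns the sum over edge sequences into the recursion of
    [walk_sum]. *)
Lemma abp_poly_eval n (G : abp F) b : size b = n -> abp_wf n G ->
  (abp_poly n G).@[fun i : 'I_n => (nth false b i : nat)%:R] =
  walk_sum (abp_edges G) (abp_nv G).-1 b (abp_nv G) 0.
Proof.
move=> bn /andP[_ /allP wG]; rewrite /abp_poly.
(* Generalising the vertex count to [K] frees the length bound for induction while the sink [w]
   stays fixed. *)
set es := abp_edges G in wG *; set w := (abp_nv G).-1; move: (abp_nv G) => K.
set e0 := (0%N, 0%N, inr 0 : nat + F).
have eval_lab i : (i < size es)%N ->
    (label_poly n (nth e0 es i).2).@[fun i : 'I_n => (nth false b i : nat)%:R]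
    = lab b (nth e0 es i).2.
  move=> iE; have /and3P[_ _] := wG _ (mem_nth e0 iE).
  case: (nth e0 es i).2 => [j jn|c _] /=; last by rewrite mevalC.
  by rewrite insubT mevalXU.
rewrite rmorph_sum /=.
pose W u k : F := \sum_(s : k.-tuple 'I_(size es) | is_path es u (map val s) w)
  \prod_(i <- s) lab b (nth e0 es i).2.
transitivity (\sum_(k < K) W 0%N k).
  apply: eq_bigr => k _; rewrite rmorph_sum; apply: eq_bigr => s _.
  by rewrite rmorph_prod; apply: eq_bigr => i _; exact: eval_lab.
have W0 u : W u 0%N = (u == w)%:R.
  rewrite /W (big_mkcond) /= (big_pred1 [tuple]); last first.
    by move=> s; rewrite [s]tuple0 /= eqxx.
  by rewrite /= big_nil; case: eqP.
have WS u k : W u k.+1 =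
    \sum_(e <- es | e.1.1 == u) lab b e.2 * W e.1.2 k.
  rewrite /W big_mkcond /= (big_tupleS k (fun s : seq 'I_(size es) =>
    if is_path es u (map val s) w then \prod_(i <- s) lab b (nth e0 es i).2 else 0)).
  rewrite (big_nth e0) big_mkord [RHS]big_mkcond; apply: eq_bigr => i _ /=.
  rewrite ltn_ord /=; case: eqP => [_|_] /=; last by rewrite big1.
  rewrite big_distrr [RHS]big_mkcond; apply: eq_bigr => s _ /=.
  by rewrite big_cons.
suff: forall u, \sum_(k < K) W u k = walk_sum es w b K u by apply.
elim: K => [|K IH] u; first by rewrite big_ord0.
rewrite big_ord_recl /= W0; congr (_ + _).
transitivity (\sum_(k < K) W u k.+1); first by apply: eq_bigr.
rewrite (eq_bigr _ (fun k _ => WS u (nat_of_ord k))) exchange_big; apply: eq_bigr => e _ /=.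
by rewrite -mulr_sumr IH.
Qed.

(** At most one instruction per edge is pushed. [q] is there to select the edges leaving a given
    vertex. *)
Lemma grows_edge_sum n P es (h : nat -> seq bool -> F) f (q : pred (nat * nat * (nat + F))) :
    pwf n P -> {in es, forall e, lab_ok n e.2} ->
    (forall e, e \in es -> computes n P (h e.1.2)) -> computes n P f ->
  exists2 Q, grows n (size es) P Q &
    computes n Q (fun b => f b + \sum_(e <- es | q e) lab b e.2 * h e.1.2 b).
Proof.
move=> wP; elim: es f => [|e es IH] f eok eh Pf.
  exists P; first exact: growsxx.
  by apply: eq_computes Pf => b _; rewrite big_nil addr0.
have [||Q gQ HQ] := IH f _ _ Pf.
- by move=> x xe; apply: eok; rewrite inE xe orbT.
- by move=> x xe; apply: eh; rewrite inE xe orbT.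
case qe: (q e); last first.
  exists Q; first by apply: grows_le gQ => /=.
  by apply: eq_computes HQ => b _; rewrite big_cons qe.
have [wQ _ HQ'] := gQ.
have [R gR HR] := grows_step wQ (eok e (mem_head _ _)) HQ
  (HQ' _ (eh e (mem_head _ _))).
exists R; first by rewrite /= -addn1; apply: grows_trans gQ gR.
by apply: eq_computes HR => b _; rewrite big_cons qe; ring.
Qed.

(** Dynamic programming: each of the [abp_nv G] rounds recomputes all vertices from the previous
    round, at a cost of at most one instruction per edge for each vertex. *)
Lemma walk_sum_comp n (G : abp F) : abp_wf n G ->
  comp n (abp_nv G * abp_nv G * size (abp_edges G))
    (fun b => walk_sum (abp_edges G) (abp_nv G).-1 b (abp_nv G) 0).
Proof.
case/andP=> nv0 /allP wG.
set es := abp_edges G in wG *; set w := (abp_nv G).-1; set N := abp_nv G in nv0 wG *.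
have eok : {in es, forall e, lab_ok n e.2} by move=> e /wG /and3P[].
suff H K : exists2 P, pwf n P & (size P <= K * N * size es)%N /\
    forall u, (u < N)%N -> computes n P (fun b => walk_sum es w b K u).
  by have [P wP [sP HP]] := H N; exists P; split=> //; apply: HP.
elim: K => [|K [P wP [sP HP]]].
  by exists [::] => //; split=> // u _; apply: computes0.
(* Vertices of one round are treated one by one; the values of the previous round stay available
   because [grows] preserves them. *)
suff H M : (M <= N)%N -> exists2 Q, grows n (M * size es) P Q &
    forall u, (u < M)%N -> computes n Q (fun b => walk_sum es w b K.+1 u).
  have [Q [wQ sQ HQ1] HQ] := H N (leqnn _); exists Q => //; split=> //; lia.
elim: M => [_|M IH MN]; first by exists P => //; exact: growsxx.
have [Q gQ HQ] := IH (ltnW MN); have [wQ sQ HQ1] := gQ.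
have c0 : computes n Q (fun=> (M == w)%:R).
  by case: eqP => _; [exact: computes1|exact: computes0].
have [|R gR HR] := grows_edge_sum (fun e => e.1.1 == M)
  (h := fun u b => walk_sum es w b K u) wQ eok _ c0.
  by move=> e /wG /and3P[_ eN _]; apply/HQ1/HP.
exists R; first by rewrite mulSn addnC; apply: grows_trans gQ gR.
move=> u; rewrite ltnS leq_eqVlt => /orP[/eqP ->|/HQ].
  exact: HR.
by case: gR => _ _; apply.
Qed.

(** * From programs to branching programs *)

Definition shift_edges es := [seq (e.1.1.+1, e.1.2.+1, e.2) | e <- es].

(* Vertex [u] of the branching program carries the value at de Bruijn position
   [u] of the final environment; the sink is the bottom entry 1. *)
Fixpoint prog_edges (P : prog F) : seq (nat * nat * (nat + F)) :=
  if P is (a, l, y) :: P' then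
    [:: (0%N, a.+1, inr 1); (0%N, y.+1, l)] ++ shift_edges (prog_edges P')
  else [::].

Lemma size_prog_edges P : size (prog_edges P) = (2 * size P)%N.
Proof.
by elim: P => [|[[a l] y] P IH] //=; rewrite size_map IH; lia.
Qed.

(** Operands lie deeper in the environment than the value they define, so every edge raises the
    index. *)
Lemma prog_edges_wf n P : pwf n P ->
  abp_wf n (ABP (size P).+2 (prog_edges P)).
Proof.
rewrite /abp_wf /=; elim: P => [|[[a l] y] P IH] //=.
move=> /and4P[wl aP yP wP]; rewrite !ltnS in aP yP *; rewrite aP yP /=.
apply/andP; split; first exact: wl.
rewrite all_map; apply: sub_all (IH wP) => e /= /and3P[h1 h2 h3].
by apply/and3P; split=> //; case: e.2 h3.
Qed.

(** This is the equation that one unfolding of [walk_sum] satisfies, with the sink at the base value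
    1. *)
Lemma prog_edges_rec n P b u : pwf n P -> (u < (size P).+2)%N ->
  (run b P)`_u = (u == (size P).+1)%:R +
    \sum_(e <- prog_edges P | e.1.1 == u) lab b e.2 * (run b P)`_e.1.2.
Proof.
elim: P u => [|[[a l] y] P IH] u /=.
  by move=> _; case: u => [|[|]] //= _; rewrite big_nil ?add0r ?addr0.
move=> /and4P[_ aP yP wP]; rewrite !big_cons big_map /=.
case: u => [_|u] /=.
  rewrite add0r mul1r; congr (_ + _).
  by rewrite big_pred0 ?addr0.
rewrite ltnS => /(IH _ wP) ->; rewrite eqSS.
by congr (_ + _); apply: eq_bigl => e; rewrite eqSS.
Qed.

(** Edges raise the index, so a walk from [u] to the sink has at most [(size P).+1 - u] edges;
    [walk_sum] admits fewer than [K], hence the bound on [K]. *)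
Lemma walk_sum_run n P b K u : pwf n P -> (u < (size P).+2)%N ->
  ((size P).+2 - u <= K)%N ->
  walk_sum (prog_edges P) (size P).+1 b K u = (run b P)`_u.
Proof.
move=> wP; elim: K u => [|K IH] u uP uK; first by lia.
rewrite (prog_edges_rec b wP uP) /=; congr (_ + _).
rewrite big_seq_cond [RHS]big_seq_cond; apply: eq_bigr => e /andP[eE /eqP eu].
have /andP[_ /allP/(_ e eE) /and3P[h1 h2 _]] := prog_edges_wf wP.
rewrite IH //; apply: leq_trans (leq_sub2l _ _) _; [exact: h1|by rewrite eu subnS; lia].
Qed.

Lemma comp_abp n s f : comp n s f ->
  exists G : abp F, [/\ abp_wf n G, (abp_size G <= 3 * s + 5)%N &
    forall b, size b = n ->
      (abp_poly n G).@[fun i : 'I_n => (nth false b i : nat)%:R] = f b].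
Proof.
move=> [P [wP sP [i iP Hi]]].
(* The extra instruction copies entry [i] to the top, because the source of a branching program is
   vertex 0. *)
pose Q : prog F := (i, inr 0, i) :: P.
have wQ : pwf n Q by rewrite /= iP.
exists (ABP (size Q).+2 (prog_edges Q)); split; first exact: prog_edges_wf.
  by rewrite /abp_size size_prog_edges /=; lia.
move=> b bn; rewrite abp_poly_eval //; last exact: prog_edges_wf.
rewrite (walk_sum_run _ wQ) //=.
by rewrite mul0r addr0 Hi.
Qed.

End BranchingPrograms.

(** * The algebra and its circuits *)

Section Algebra.
Variable F : finFieldType.

(** Subtracting [v.1] from [s.1] makes the product vanish for [s = v], which leaves the Malcev
    operation [u - v + w]; for [v = w = 0] the product [s.1 * t.2] is added to [u.2]. *)
Definition bilin_op (u v w s t : F * F) : F * F :=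
  (u.1 - v.1 + w.1, u.2 - v.2 + w.2 + (s.1 - v.1) * t.2).

Definition bilin_alg : finAlg :=
  @FinAlg (F * F)%type 1 (fun=> 5%N) (fun _ x =>
    bilin_op (tnth x (@Ordinal 5 0 isT)) (tnth x (@Ordinal 5 1 isT))
      (tnth x (@Ordinal 5 2 isT)) (tnth x (@Ordinal 5 3 isT))
      (tnth x (@Ordinal 5 4 isT))).

Lemma op_seqE (x0 : bilin_alg) i (vs : seq bilin_alg) :
  op_seq x0 i vs = bilin_op (nth x0 vs 0) (nth x0 vs 1) (nth x0 vs 2)
                            (nth x0 vs 3) (nth x0 vs 4).
Proof. by rewrite /op_seq /= !tnth_mktuple. Qed.

(** The hypothesis ranges over all positions [j]; those beyond the list give variable 0, matching
    the padding value [e 0] of [teval]. *)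
Lemma term_nth_ind k (Q : term k -> Prop) :
    (forall i, Q (TVar k i)) ->
    (forall f ts, (forall j, Q (nth (TVar k 0) ts j)) -> Q (TOp f ts)) ->
  forall t, Q t.
Proof.
move=> QV QO; fix IH 1 => -[i|f ts]; first exact: QV.
apply: QO; elim: ts => [|t ts IHs] [|j]; [exact: QV|exact: QV|exact: IH|exact: IHs].
Qed.

Lemma teval_op (e : nat -> bilin_alg) f (ts : seq (term (nops bilin_alg))) :
  let v j := teval e (nth (TVar _ 0) ts j) in
  teval e (TOp f ts) = bilin_op (v 0%N) (v 1%N) (v 2%N) (v 3%N) (v 4%N).
Proof.
have nthE j : nth (e 0%N) (map (teval e) ts) j = teval e (nth (TVar _ 0) ts j).
  case: (ltnP j (size ts)) => jts; first by rewrite (nth_map (TVar _ 0)).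
  by rewrite !nth_default ?size_map.
by move=> v; rewrite -[LHS]/(op_seq (e 0%N) f (map (teval e) ts)) op_seqE !nthE.
Qed.

Lemma bilin_alg_malcev : has_malcev bilin_alg.
Proof.
exists (TOp ord0 [:: TVar _ 0; TVar _ 1; TVar _ 2; TVar _ 1; TVar _ 1]).
split=> // -[x1 x2] [y1 y2]; rewrite !teval_op /bilin_op /=.
by split; congr pair; ring.
Qed.

(** The kernel of the first projection serves as [delta]. First coordinates of terms are affine, so
    the change caused by the y-variables does not depend on the x-variables; this is the term
    condition. *)
Lemma derived1_fst x y : derived (A := bilin_alg) 1 x y -> x.1 = y.1.
Proof.
move=> /(_ (fun x y => x.1 = y.1)); apply => [|m t X a b c d _ _ _ /=].
  split=> //; first by move=> x' y' z' -> ->.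
  by move=> f u v uv; rewrite /= !uv.
(* [e p q] gives the four corners of the term condition: [p] switches the x-variables, [q] the
   y-variables. *)
pose e (p q : bool) i := if X i then if p then b i else a i
                        else if q then d i else c i.
rewrite -/(e false false) -/(e false true) -/(e true false) -/(e true true).
suff key : (teval (e true false) t).1 - (teval (e true true) t).1 =
    (teval (e false false) t).1 - (teval (e false true) t).1.
  by move=> E; apply/eqP; rewrite -subr_eq0 key E subrr.
elim/term_nth_ind: t => [i|f ts IH].
  by rewrite /= /e; case: (X i); rewrite ?subrr.
rewrite !teval_op /=; have := (IH 0%N, IH 1%N, IH 2%N) => -[[]].
move=> /eqP + /eqP + /eqP; rewrite !subr_eq => /eqP-> /eqP-> /eqP->; ring.
Qed.

(** Values related by the first derived congruence share their first coordinate, so each multiplier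
    [s.1 - v.1] is the same at all four corners. Second coordinates then behave affinely, and the
    term condition holds with equality as [delta]. *)
Lemma bilin_alg_solvable : solvable_alg bilin_alg.
Proof.
exists 2%N => x y; split=> [|-> delta [] //].
move=> /(_ eq); apply => [|m t X a b c d _ ab cd /=].
  split=> //; first by move=> x' y' z' -> ->.
  by move=> f u v uv; congr op; apply: eq_from_tnth.
have ab1 i := derived1_fst (ab i); have cd1 i := derived1_fst (cd i).
pose e (p q : bool) i := if X i then if p then b i else a i
                        else if q then d i else c i.
rewrite -/(e false false) -/(e false true) -/(e true false) -/(e true true).
have fst_eq p q t' : (teval (e p q) t').1 = (teval (e false false) t').1.
  elim/term_nth_ind: t' => [i|f ts IH].
    by rewrite /= /e; case: (X i); case: p q => [] [] //=; rewrite ?ab1 ?cd1.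
  by rewrite !teval_op /= !IH.
have snd_eq : (teval (e true false) t).2 - (teval (e true true) t).2 =
    (teval (e false false) t).2 - (teval (e false true) t).2.
  elim/term_nth_ind: t => [i|f ts IH].
    by rewrite /= /e; case: (X i); rewrite ?subrr.
  (* One pass of rewriting for each of the two first coordinates in the multiplier, [s.1] and
     [v.1]. *)
  rewrite !teval_op /= (fst_eq true true) (fst_eq true false) (fst_eq false true).
  rewrite (fst_eq true true) (fst_eq true false) (fst_eq false true).
  have := (IH 0%N, IH 1%N, IH 2%N, IH 4%N) => -[[[]]].
  move=> /eqP + /eqP + /eqP + /eqP; rewrite !subr_eq.
  by move=> /eqP-> /eqP-> /eqP-> /eqP->; ring.
move=> E; rewrite [LHS]surjective_pairing [RHS]surjective_pairing !fst_eq.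
by congr pair; apply/eqP; rewrite -subr_eq0 snd_eq E subrr.
Qed.


Implicit Types (n : nat) (f g h : seq bool -> F) (P Q : prog F).

(** * From circuits to programs *)

Definition affine n f : Prop :=
  exists (c0 : F) (c : nat -> F), forall b, size b = n ->
    f b = c0 + \sum_(i < n) c i * (nth false b i : nat)%:R.

Lemma affineD n f g : affine n f -> affine n g -> affine n (fun b => f b + g b).
Proof.
move=> [c0 [c Hf]] [d0 [d Hg]]; exists (c0 + d0), (fun i => c i + d i) => b bn.
rewrite Hf // Hg // addrACA -big_split; congr (_ + _).
by apply: eq_bigr => i _; rewrite mulrDl.
Qed.

Lemma affineB n f g : affine n f -> affine n g -> affine n (fun b => f b - g b).
Proof.
move=> Hf [d0 [d Hg]]; apply: affineD Hf _; exists (- d0), (fun i => - d i) => b bn.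
rewrite Hg // opprD -sumrN; congr (_ + _).
by apply: eq_bigr => i _; rewrite mulNr.
Qed.

Lemma affine_const n (c : F) : affine n (fun=> c).
Proof.
by exists c, (fun=> 0) => b _; rewrite big1 ?addr0 // => i _; rewrite mul0r.
Qed.

Lemma affine_input n (phi : bool -> F) i : (i < n)%N ->
  affine n (fun b => phi (nth false b i)).
Proof.
move=> iN; exists (phi false), (fun j => if j == i then phi true - phi false else 0).
move=> b bn; rewrite (bigD1 (Ordinal iN)) //= eqxx big1 => [|j].
  by case: (nth false b i); rewrite ?mulr1 ?mulr0; ring.
by rewrite -val_eqE /= => /negPf ->; rewrite mul0r.
Qed.

(** An instruction multiplies by a single label: one instruction serves the constant term, and each
    variable takes two, first by its coefficient and then by the input bit. *)
Lemma grows_affine n P f g h :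
    pwf n P -> affine n f -> computes n P g -> computes n P h ->
  exists2 Q, grows n (2 * n).+1 P Q & computes n Q (fun b => h b + f b * g b).
Proof.
move=> wP [c0 [c Hf]] Pg Ph.
suff H m : (m <= n)%N -> exists2 Q, grows n (2 * m).+1 P Q & computes n Q
    (fun b => h b + (c0 + \sum_(i < m) c i * (nth false b i : nat)%:R) * g b).
  have [Q gQ HQ] := H n (leqnn n); exists Q => //.
  by apply: eq_computes HQ => b bn; rewrite Hf.
elim: m => [_|m IH mn].
  have [Q gQ HQ] := grows_step wP (isT : lab_ok n (inr c0)) Ph Pg.
  by exists Q => //; apply: eq_computes HQ => b _; rewrite big_ord0 addr0.
have [Q gQ HQ] := IH (ltnW mn); have [wQ _ PQ] := gQ.
have [R gR HR] :=
  grows_step wQ (isT : lab_ok n (inr (c m))) (computes0 n Q) (PQ _ Pg).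
have [wR _ QR] := gR.
have [S gS HS] := grows_step wR (mn : lab_ok n (inl m)) (QR _ HQ) HR.
exists S; first by apply: grows_le (grows_trans gQ (grows_trans gR gS)); lia.
by apply: eq_computes HS => b _; rewrite big_ord_recr /=; ring.
Qed.

Notation A := bilin_alg.

(** [node_val] and [node_ok] name the per-node bodies of [cvals] and [cwf_from], so that unfolding
    these by one node holds by conversion. *)
Definition node_val (x0 : A) (inp vals : seq A) (nd : cnode A) : A :=
  match nd with
  | CVar i => nth x0 inp i
  | CConst a => a
  | CGate k args => op_seq x0 k (map (nth x0 vals) args)
  end.

Definition node_ok n j (nd : cnode A) : bool :=
  match nd with
  | CVar i => (i < n)%N
  | CConst _ => true
  | CGate k args => (size args == arity k) && all (fun u => (u < j)%N) args
  end.

(** Only second coordinates are stored in the program; first coordinates are kept as affine forms,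
    to be used as multipliers. *)
Definition tracks n j x0 (vals : seq bool -> seq A) P : Prop :=
  forall i, (i < j)%N -> affine n (fun b => (nth x0 (vals b) i).1) /\
                         computes n P (fun b => (nth x0 (vals b) i).2).

Lemma op_seq_map x0 k (vals : seq A) u v w s t :
  op_seq x0 k (map (nth x0 vals) [:: u; v; w; s; t]) =
  bilin_op (nth x0 vals u) (nth x0 vals v) (nth x0 vals w)
           (nth x0 vals s) (nth x0 vals t).
Proof. by rewrite op_seqE. Qed.

Lemma grows_node n (iota : bool -> A) x0 j vals nd P :
    node_ok n j nd -> pwf n P -> tracks n j x0 vals P ->
  exists2 Q, grows n (2 * n + 3) P Q &
    affine n (fun b => (node_val x0 (map iota b) (vals b) nd).1) /\
    computes n Q (fun b => (node_val x0 (map iota b) (vals b) nd).2).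
Proof.
case: nd => [i|a|k args] ok wP trP.
- have nthE b : size b = n -> nth x0 (map iota b) i = iota (nth false b i).
    by move=> bn; rewrite (nth_map false) ?bn.
  have [Q gQ HQ] := grows_affine wP (affine_input (fun x => (iota x).2) ok)
    (computes1 n P) (computes0 n P).
  exists Q; first by apply: grows_le gQ; lia.
  split; last by apply: eq_computes HQ => b bn; rewrite /= nthE // add0r mulr1.
  have [c0 [c Hc]] := affine_input (fun x => (iota x).1) ok.
  by exists c0, c => b bn; rewrite /= nthE // Hc.
- have [Q gQ HQ] := grows_affine wP (affine_const n a.2)
    (computes1 n P) (computes0 n P).
  exists Q; first by apply: grows_le gQ; lia.
  split; first exact: affine_const.
  by apply: eq_computes HQ => b bn; rewrite add0r mulr1.
case: args ok => [|u [|v [|w [|s [|t [|? ?]]]]]] // /and5P[_ uj vj wj /and3P[sj tj _]].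
have [[u1 u2] [v1 v2]] := (trP u uj, trP v vj).
have [[w1 w2] [s1 _] [_ t2]] := And3 (trP w wj) (trP s sj) (trP t tj).
(* Two instructions build [u.2 - v.2 + w.2]; the affine multiplier [s.1 - v.1] then accounts for the
   remaining [2 * n + 1]. *)
have [Q gQ HQ] := grows_step wP (isT : lab_ok n (inr (-1))) u2 v2.
have [wQ _ PQ] := gQ.
have [R gR HR] := grows_step wQ (isT : lab_ok n (inr 1)) HQ (PQ _ w2).
have [wR _ QR] := gR.
have [S gS HS] := grows_affine wR (affineB s1 v1) (QR _ (PQ _ t2)) HR.
exists S; first by apply: grows_le (grows_trans gQ (grows_trans gR gS)); lia.
split.
  have [c0 [c Hc]] := affineD (affineB u1 v1) w1.
  by exists c0, c => b bn; rewrite /node_val op_seq_map -Hc.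
apply: eq_computes HS => b _; rewrite /node_val op_seq_map /=; ring.
Qed.

Lemma cwf_from_cons n j nd (c : circuit A) :
  cwf_from n j (nd :: c) = node_ok n j nd && cwf_from n j.+1 c.
Proof. by []. Qed.

Lemma cvals_cons x0 inp vals nd (c : circuit A) :
  cvals x0 inp vals (nd :: c) =
  cvals x0 inp (rcons vals (node_val x0 inp vals nd)) c.
Proof. by []. Qed.

Lemma grows_circuit n (iota : bool -> A) x0 j vals (c : circuit A) P :
    cwf_from n j c -> pwf n P -> (forall b, size b = n -> size (vals b) = j) ->
    tracks n j x0 vals P ->
  exists2 Q, grows n (size c * (2 * n + 3)) P Q &
    tracks n (j + size c) x0 (fun b => cvals x0 (map iota b) (vals b) c) Q.
Proof.
elim: c j vals P => [|nd c IH] j vals P.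
  by move=> _ wP _ trP; exists P; [exact: growsxx|rewrite addn0].
rewrite cwf_from_cons => /andP[ok wc] wP szv trP.
have [Q gQ [HQ1 HQ2]] := grows_node iota ok wP trP.
have [wQ _ PQ] := gQ.
pose vals' b := rcons (vals b) (node_val x0 (map iota b) (vals b) nd).
have szv' b : size b = n -> size (vals' b) = j.+1.
  by move=> bn; rewrite size_rcons szv.
have trQ : tracks n j.+1 x0 vals' Q.
  move=> i; rewrite ltnS leq_eqVlt => /orP[/eqP->|ij].
    have E b : size b = n ->
        nth x0 (vals' b) j = node_val x0 (map iota b) (vals b) nd.
      by move=> bn; rewrite nth_rcons szv // ltnn eqxx.
    split; last by apply: eq_computes HQ2 => b bn; rewrite E.
    by have [c0 [d Hd]] := HQ1; exists c0, d => b bn; rewrite E // Hd.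
  have E b : size b = n -> nth x0 (vals' b) i = nth x0 (vals b) i.
    by move=> bn; rewrite nth_rcons szv // ij.
  have [H1 H2] := trP i ij.
  split; last by apply/PQ; apply: eq_computes H2 => b bn; rewrite E.
  by have [c0 [d Hd]] := H1; exists c0, d => b bn; rewrite E // Hd.
have [R gR HR] := IH _ _ _ wc wQ szv' trQ.
exists R; first by rewrite mulSn; apply: grows_trans gQ gR.
by rewrite /= addnS -addSn.
Qed.

Lemma size_cvals x0 inp vals (c : circuit A) :
  size (cvals x0 inp vals c) = (size vals + size c)%N.
Proof.
by elim: c vals => [|nd c IH] vals /=; rewrite ?addn0 // IH size_rcons addnS.
Qed.

(** Programs exist for both coordinates of the output node, and membership in [S] is a fixed
    function of these two values. *)
Lemma comp_circuit n (iota : bool -> A) x0 (c : circuit A) (S : {set A}) :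
    cwf n c ->
  comp n (#|{: F * F}| * (#|F| * ((size c).+1 * (2 * n + 3) + 20))).+1
    (fun b => (ceval x0 (map iota b) c \in S)%:R : F).
Proof.
move=> /andP[c0 wc].
have [//|//|Q [wQ sQ _] HQ] :=
  @grows_circuit n iota x0 0 (fun=> [::]) c [::] wc isT.
have iC : ((size c).-1 < 0 + size c)%N by rewrite add0n prednK.
have [H1 H2] := HQ _ iC.
have outE b : nth x0 (cvals x0 (map iota b) [::] c) (size c).-1 =
    ceval x0 (map iota b) c by rewrite /ceval -nth_last size_cvals.
have C1 : comp n (2 * n).+1 (fun b => (ceval x0 (map iota b) c).1).
  have [R [wR sR _] HR] :=
    grows_affine (isT : pwf n [::]) H1 (computes1 n [::]) (computes0 n [::]).
  exists R; split=> //.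
  by apply: eq_computes HR => b bn; rewrite outE add0r mulr1.
have C2 : comp n (size c * (2 * n + 3)) (fun b => (ceval x0 (map iota b) c).2).
  by exists Q; split=> //; apply: eq_computes H2 => b bn; rewrite outE.
have := comp_fun2 (fun x y => ((x, y) \in S)%:R) C1 C2.
move=> /(@comp_le F n _ _ _ _) h; apply: eq_comp (h _ _) => [b bn|].
  by rewrite -surjective_pairing.
by rewrite ltnS leq_mul // leq_mul //; nia.
Qed.

(** * From programs to circuits *)

Definition bool_iota (x : bool) : A := ((x : nat)%:R, 0).

Definition bilin0 : A := (0, 0).

Definition circuit_has n (c : circuit A) (v : seq bool -> A) : Prop :=
  exists2 j, (j < size c)%N & forall b, size b = n ->
    nth bilin0 (cvals bilin0 (map bool_iota b) [::] c) j = v b.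

Lemma cvals_rcons x0 inp vals (c : circuit A) nd :
  cvals x0 inp vals (rcons c nd) =
  rcons (cvals x0 inp vals c) (node_val x0 inp (cvals x0 inp vals c) nd).
Proof. by elim: c vals => [|nd' c IH] vals //; rewrite rcons_cons !cvals_cons IH. Qed.

Lemma cwf_from_rcons n j (c : circuit A) nd :
  cwf_from n j (rcons c nd) = cwf_from n j c && node_ok n (j + size c) nd.
Proof.
elim: c j => [|nd' c IH] j.
  by rewrite cwf_from_cons /= andbT addn0.
by rewrite rcons_cons !cwf_from_cons IH andbA addSnnS.
Qed.

Lemma circuit_has_rcons n (c : circuit A) nd v :
  circuit_has n c v -> circuit_has n (rcons c nd) v.
Proof.
move=> [j jc Hj]; exists j; first by rewrite size_rcons leqW.
by move=> b bn; rewrite cvals_rcons nth_rcons size_cvals add0n jc Hj.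
Qed.

Lemma circuit_has_last n (c : circuit A) nd v :
    (forall b, size b = n -> node_val bilin0 (map bool_iota b)
       (cvals bilin0 (map bool_iota b) [::] c) nd = v b) ->
  circuit_has n (rcons c nd) v.
Proof.
move=> Hv; exists (size c); first by rewrite size_rcons.
by move=> b bn; rewrite cvals_rcons nth_rcons size_cvals add0n ltnn eqxx Hv.
Qed.

Lemma circuit_has_gate n (c : circuit A) vu vv vw vs vt :
    cwf_from n 0 c ->
    circuit_has n c vu -> circuit_has n c vv -> circuit_has n c vw ->
    circuit_has n c vs -> circuit_has n c vt ->
  exists2 nd, cwf_from n 0 (rcons c nd) &
    forall b, size b = n ->
      node_val bilin0 (map bool_iota b) (cvals bilin0 (map bool_iota b) [::] c) nd
      = bilin_op (vu b) (vv b) (vw b) (vs b) (vt b).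
Proof.
move=> wc [u uc Hu] [v vc Hv] [w wc' Hw] [s sc Hs] [t tc Ht].
exists (CGate (ord0 : 'I_(nops A)) [:: u; v; w; s; t]).
  by rewrite cwf_from_rcons wc /= uc vc wc' sc tc.
by move=> b bn; rewrite [LHS]op_seq_map Hu // Hv // Hw // Hs // Ht.
Qed.

(** Program values sit in second coordinates and labels in first ones. An instruction becomes two
    nodes: the label [(lab b l, 0)], and a gate with [v = w = 0] that adds label times value. The
    base values 0 and 1 give the two extra nodes. *)
Lemma prog_circuit n P : pwf n P ->
  exists c : circuit A, [/\ cwf_from n 0 c, size c = (2 * size P + 2)%N &
    forall f, computes n P f -> circuit_has n c (fun b => (0, f b))].
Proof.
elim: P => [|[[a l] y] P IH].
  move=> _; exists [:: CConst bilin0; CConst ((0, 1) : A)]; split=> //.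
  move=> f [[|[|//]] _ Hi]; [exists 0%N|exists 1%N] => // b bn /=; by rewrite -Hi.
move=> /= /and4P[wl aP yP /IH[c [wc sc Hc]]].
pose nd : cnode A := match l with inl i => CVar _ i | inr d => CConst ((d, 0) : A) end.
have wc1 : cwf_from n 0 (rcons c nd).
  by rewrite cwf_from_rcons wc /nd; case: l wl {nd}.
have ndE : circuit_has n (rcons c nd) (fun b => (lab b l, 0)).
  apply: circuit_has_last => b bn; rewrite /nd; case: l wl {nd wc1} => //= i iN.
  by rewrite (nth_map false) ?bn.
have old f : computes n P f -> circuit_has n (rcons c nd) (fun b => (0, f b)).
  by move=> /Hc; apply: circuit_has_rcons.
have z := old _ (computes0 n P).
have va : computes n P (fun b => (run b P)`_a) by exists a.
have vy : computes n P (fun b => (run b P)`_y) by exists y.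
have [nd' wc2 nd'E] := circuit_has_gate wc1 (old _ va) z z ndE (old _ vy).
exists (rcons (rcons c nd) nd'); split=> //.
  by rewrite !size_rcons sc /=; lia.
move=> f [[|i] /= iP Hi].
  apply: circuit_has_last => b bn; rewrite nd'E // -Hi //= /bilin_op /=.
  by congr pair; ring.
apply: circuit_has_rcons; apply: old; exists i => // b bn; exact: Hi.
Qed.

(** Each node counts once and has at most five incoming edges. *)
Lemma csize_le n j (c : circuit A) : cwf_from n j c -> (csize c <= 6 * size c)%N.
Proof.
rewrite /csize; elim: c j => [|nd c IH] j; first by rewrite big_nil.
rewrite cwf_from_cons big_cons => /andP[ok /IH] /=.
have : (node_size nd <= 5)%N by case: nd ok => //= k args /andP[/eqP-> _].
set X := bigop _ _ _; move: (node_size nd) => Y; lia.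
Qed.

Lemma comp_to_circuit n s f : comp n s f ->
  exists c : circuit A, [/\ cwf n c, (csize c <= 6 * (2 * s + 3))%N &
    forall b, size b = n -> (ceval bilin0 (map bool_iota b) c) = (0, f b)].
Proof.
move=> [P [wP sP Pf]]; have [c [wc sc Hc]] := prog_circuit wP.
have z := Hc _ (computes0 n P).
(* A final gate with four zero arguments copies [(0, f b)] to the last node, which is the output. *)
have [nd wc1 ndE] := circuit_has_gate wc (Hc _ Pf) z z z z.
exists (rcons c nd); split.
- by rewrite /cwf wc1 size_rcons.
- by apply: leq_trans (csize_le wc1) _; rewrite size_rcons sc; lia.
move=> b bn; rewrite /ceval cvals_rcons last_rcons ndE // /bilin_op /=.
by congr pair; ring.
Qed.

End Algebra.

(** * Language classes *)

Definition poly_bounded (s : nat -> nat) : Prop :=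
  exists k, forall n, (s n <= n ^ k + k)%N.

Lemma poly_bounded_le s t :
  (forall n, s n <= t n)%N -> poly_bounded t -> poly_bounded s.
Proof. by move=> st [k tk]; exists k => n; apply: leq_trans (st n) (tk n). Qed.

Lemma poly_bounded_const c : poly_bounded (fun=> c).
Proof. by exists c => n; apply: leq_addl. Qed.

Lemma poly_bounded_id : poly_bounded id.
Proof. by exists 1%N => n; rewrite expn1 leq_addr. Qed.

Lemma poly_boundedM s t : poly_bounded s -> poly_bounded t ->
  poly_bounded (fun n => s n * t n)%N.
Proof.
move=> [k sk] [l tl]; exists ((k.+1 * l.+1) + k + l + 2)%N => n.
apply: leq_trans (leq_mul (sk n) (tl n)) _.
(* At 0 and 1 powers do not grow and the additive part of the bound is used; from base 2 on, the
   summand [m] is absorbed by raising the exponent by one. *)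
case: n {sk tl} => [|[|n]]; first by case: k l => [|k] [|l]; rewrite ?expn0 ?exp0n //; nia.
  by rewrite !exp1n; nia.
have le_pow m : (n.+2 ^ m + m <= n.+2 ^ m.+1)%N.
  rewrite expnS; have : (m < n.+2 ^ m)%N by apply: ltn_expl.
  by nia.
apply: leq_trans (leq_mul (le_pow k) (le_pow l)) _; rewrite -expnD.
by apply: leq_trans (leq_addr _ _); rewrite leq_pexp2l //; nia.
Qed.

Lemma poly_boundedD s t : poly_bounded s -> poly_bounded t ->
  poly_bounded (fun n => s n + t n)%N.
Proof.
have succ u : poly_bounded u -> poly_bounded (fun n => (u n).+1).
  move=> [k uk]; exists k.+2 => n; apply: leq_ltn_trans (uk n) _.
  case: n {uk} => [|n]; first by case: k => [|k]; rewrite ?expn0 ?exp0n //; lia.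
  have : (n.+1 ^ k <= n.+1 ^ k.+2)%N by rewrite leq_pexp2l //; lia.
  by lia.
(* A sum is bounded by the product of the successors. *)
move=> bs bt; apply: poly_bounded_le (poly_boundedM (succ _ bs) (succ _ bt)).
by move=> n /=; nia.
Qed.

(** Languages are arbitrary predicates in [Prop], hence the classical case distinction. *)
Definition charfun (R : nzRingType) (L : seq bool -> Prop) (b : seq bool) : R :=
  if excluded_middle_informative (L b) then 1 else 0.

Lemma charfunP (R : nzRingType) L b : charfun R L b = 1 <-> L b.
Proof.
rewrite /charfun; case: excluded_middle_informative => // nL; split=> // /eqP.
by rewrite eq_sym oner_eq0.
Qed.

Lemma charfun_bool (R : nzRingType) L b (x : bool) :
  (L b <-> x) -> x%:R = charfun R L b.
Proof.
rewrite /charfun => Lx; case: excluded_middle_informative => [/Lx -> //|nL].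
by case: x Lx => // -[_ /(_ isT)].
Qed.

(** The intermediate class through which the two models are compared. *)
Definition prog_class (F : finFieldType) (L : seq bool -> Prop) : Prop :=
  exists2 s, poly_bounded s & forall n, comp n (s n) (charfun F L).

Lemma prog_class_nuDet p L : prime p -> prog_class 'F_p L <-> nuDet p L.
Proof.
move=> p_pr; split.
  move=> [s bs Hs].
  have [k Hk] : poly_bounded (fun n => 3 * s n + 5)%N.
    apply: poly_boundedD (poly_bounded_const 5).
    exact: poly_boundedM (poly_bounded_const 3) bs.
  exists k => n; have [G [wG sG HG]] := comp_abp (Hs n).
  exists G, (pred1 1); split=> //; first exact: leq_trans sG (Hk n).
  move=> b bn; rewrite /babp_accepts HG // inE.
  by split=> [/charfunP->|/eqP/charfunP].
move=> [k Hk]; pose t n := (n ^ k + k)%N.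
have bt : poly_bounded t by exists k.
exists (fun n => (#|{: 'F_p * 'F_p}| * (#|'F_p| * (t n * t n * t n + 21))).+1).
  apply: poly_bounded_le (poly_boundedD (poly_bounded_const 1)
    (poly_boundedM (poly_bounded_const _) (poly_boundedM (poly_bounded_const _)
      (poly_boundedD (poly_boundedM (poly_boundedM bt bt) bt) (poly_bounded_const 21))))).
  by move=> n; rewrite add1n.
move=> n; have [G [T [wG sG HG]]] := Hk n.
(* The accepting set becomes a function of one value; the constant 0 fills the second slot. *)
have := comp_fun2 (fun x _ => (x \in T)%:R) (walk_sum_comp wG) (comp_const n 0).
move=> /(@comp_le _ n _ _ _ _) h; apply: eq_comp (h _ _) => [b bn|].
  by apply: charfun_bool; rewrite HG // /babp_accepts abp_poly_eval.
rewrite ltnS leq_mul // leq_mul //.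
move: sG; rewrite /abp_size -/(t n) => sG.
have h1 : (abp_nv G <= t n)%N by lia.
have h2 : (size (abp_edges G) <= t n)%N by lia.
by rewrite -addnA leq_add // leq_mul // leq_mul.
Qed.

Lemma prog_class_nuP (F : finFieldType) L :
  prog_class F L <-> nuP (bilin_alg F) L.
Proof.
split.
  move=> [s bs Hs].
  have [k Hk] : poly_bounded (fun n => 6 * (2 * s n + 3))%N.
    apply: poly_boundedM (poly_bounded_const 6) _.
    apply: poly_boundedD (poly_bounded_const 3).
    exact: poly_boundedM (poly_bounded_const 2) bs.
  (* Choice assembles the circuits obtained for each length into one family. *)
  pose t n := proj1_sig (constructive_indefinite_description _
    (comp_to_circuit (Hs n))).
  have tP n : [/\ cwf n (t n), (csize (t n) <= 6 * (2 * s n + 3))%N &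
      forall b, size b = n -> ceval (bilin0 F) (map (@bool_iota F) b) (t n)
        = (0, charfun F L b)].
    by rewrite /t; case: constructive_indefinite_description.
  exists t, (@bool_iota F), [set x : F * F | x.2 == 1], k; split=> [n _|b _].
    by have [w sz _] := tP n; split=> //; apply: leq_trans sz (Hk n).
  have [_ _ HT] := tP (size b); rewrite HT // inE /=.
  by split=> [/charfunP->|/eqP/charfunP].
move=> [t [iota [S [k [wt HL]]]]]; pose s n := (n ^ k + k)%N.
have bs : poly_bounded s by exists k.
exists (fun n => (#|{: F * F}| * (#|F| * ((s n + 1) * (2 * n + 3) + 20))).+1).
  apply: poly_bounded_le (poly_boundedD (poly_bounded_const 1)
    (poly_boundedM (poly_bounded_const _) (poly_boundedM (poly_bounded_const _)
      (poly_boundedD (poly_boundedM (poly_boundedD bs (poly_bounded_const 1))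
        (poly_boundedD (poly_boundedM (poly_bounded_const 2) poly_bounded_id)
          (poly_bounded_const 3))) (poly_bounded_const 20))))).
  by move=> n; rewrite add1n.
(* A NuDFA says nothing about the empty word, so at length 0 the value of [charfun] is hardwired as
   a constant. *)
case=> [|n].
  apply: comp_le (_ : 1 <= _)%N _ => //.
  by apply: eq_comp (comp_const 0 (charfun F L [::])) => b /size0nil ->.
have [wn sn] := wt n.+1 isT.
move: (comp_circuit iota (iota false) S wn).
move=> /(@comp_le F n.+1 _ _ _ _) h; apply: eq_comp (h _ _) => [b bn|].
  by apply: charfun_bool; rewrite HL ?bn.
rewrite ltnS leq_mul // leq_mul // leq_add2r leq_mul //.
by rewrite addn1 ltnS; apply: leq_trans sn; apply: leq_addr.
Qed.

Theorem mainTheorem7 :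
  forall p : nat, prime p ->
  exists A : finAlg,
    [/\ solvable_alg A, has_malcev A &
        forall L : seq bool -> Prop, nuP A L <-> nuDet p L].
Proof.
move=> p p_pr; exists (bilin_alg 'F_p); split.
- exact: bilin_alg_solvable.
- exact: bilin_alg_malcev.
by move=> L; rewrite -prog_class_nuP prog_class_nuDet.
Qed.
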